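(* Let $X$ be a separable infinite-dimensional Banach space, let $T$ be a bounded linear operator on $X$ and let $n\ge 1$. (1) If $T$ is $\mathcal{U}$-frequently hypercyclic, then the $n$-fold product $T\times\cdots\times T$ is $\mathcal{U}$-frequently hypercyclic. (2) If $T$ is reiteratively hypercyclic, then the $n$-fold product $T\times\cdots\times T$ is reiteratively hypercyclic.
   Context: $\mathbb{N}=\{0,1,2,\dots\}$. For $A\subseteq\mathbb{N}$: $\overline{d}(A)=\limsup_{N\to+\infty}\frac{\#([0,N]\cap A)}{N+1}$ is the upper density, and $\overline{Bd}(A)=\lim_{N\to+\infty}\frac{b_N}{N}$, with $b_N=\limsup_{k\to+\infty}\#(A\cap[k+1,k+N])$, is the upper Banach density. For a bounded operator $S$ on a Banach space $Y$, $y\in Y$ and $U\subseteq Y$, let $N(y,U)=\{n\in\mathbb{N}: S^ny\in U\}$. The operator $S$ is $\mathcal{U}$-frequently hypercyclic (resp. reiteratively hypercyclic) if there is $y\in Y$ such that $\overline{d}(N(y,U))>0$ (resp. $\overline{Bd}(N(y,U))>0$) for every non-empty open set $U\subseteq Y$. The $n$-fold product $T\times\cdots\times T$ is the operator $(x_1,\dots,x_n)\mapsto(Tx_1,\dots,Tx_n)$ on $X^n$ (product topology). *)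

(* Defs.v *)
From HB Require Import structures.
From mathcomp Require Import all_boot all_order all_algebra finmap.
From mathcomp Require Import all_classical all_reals all_analysis.
From mathcomp Require Import complex.

Set Implicit Arguments.
Unset Strict Implicit.
Unset Printing Implicit Defensive.

Import Order.TTheory GRing.Theory Num.Theory.
Import numFieldNormedType.Exports.

Local Open Scope classical_set_scope.
Local Open Scope ring_scope.

(* "Banach space" means real or complex Banach space; in the complex case the
   library takes the norm with values in the nonnegative real elements of
   [R[i]]. *)
Variant scalar_kind := RealScalars | ComplexScalars.

Definition scalars (R : realType) (k : scalar_kind) : numFieldType :=
  match k with
  | RealScalars => R
  | ComplexScalars => R[i]
  end.

Definition separable_space (Y : topologicalType) : Prop :=
  exists2 D : set Y, countable D & dense D.

Definition finite_dimensional (K : numFieldType) (V : lmodType K) : Prop :=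
  exists (m : nat) (e : 'I_m -> V),
    forall v : V, exists c : 'I_m -> K, v = \sum_(i < m) c i *: e i.

(* The cardinal of [A `&` `[a, b]]; note that [fset_set] of an infinite set
   would be empty, but an interval of [nat] is finite. *)
Definition card_itv (A : set nat) (a b : nat) : nat :=
  #|` fset_set (A `&` `[a, b]%classic)|%fset.

(* All the sequences below are bounded, so the real-valued [limn_sup] (the
   limit of the suprema of the tails) is the usual upper limit. *)
Definition upper_density (R : realType) (A : set nat) : R :=
  limn_sup (fun N : nat => (card_itv A 0 N)%:R / N.+1%:R : R^o).

Definition banach_count (R : realType) (A : set nat) (N : nat) : R :=
  limn_sup (fun k : nat => (card_itv A (k + 1)%N (k + N)%N)%:R : R^o).

(* [banach_count R A] is subadditive in [N], so the limit exists. The term at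
   [N = 0] is the harmless [0 / 0 = 0]. *)
Definition upper_banach_density (R : realType) (A : set nat) : R :=
  limn (fun N : nat => banach_count R A N / N%:R : R^o).

Definition return_set (Y : Type) (S : Y -> Y) (y : Y) (U : set Y) : set nat :=
  [set m | U (iter m S y)].

(* The two notions of hypercyclicity involve only the topology of the space;
   [R] is the real field in which densities are computed. *)
Definition U_frequently_hypercyclic (R : realType) (Y : topologicalType)
    (S : Y -> Y) : Prop :=
  exists y : Y, forall U : set Y, open U -> U !=set0 ->
    0 < upper_density R (return_set S y U).

Definition reiteratively_hypercyclic (R : realType) (Y : topologicalType)
    (S : Y -> Y) : Prop :=
  exists y : Y, forall U : set Y, open U -> U !=set0 ->
    0 < upper_banach_density R (return_set S y U).

(* [{ptws 'I_n -> X}] carries the product topology. *)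
Definition prod_map (X : Type) (n : nat) (T : X -> X)
    (x : {ptws 'I_n -> X}) : {ptws 'I_n -> X} := fun i => T (x i).

(* Main.v *)
Require Import Defs.
From HB Require Import structures.
From mathcomp Require Import all_boot all_order all_algebra finmap.
From mathcomp Require Import all_classical all_reals all_analysis.
From mathcomp Require Import complex.
From mathcomp Require Import zify lra.
Import Order.TTheory GRing.Theory Num.Theory.
Import numFieldNormedType.Exports.
Local Open Scope classical_set_scope.
Local Open Scope ring_scope.

(** Write [N(x, U)] for the times at which the orbit of [x] visits [U], and
    [N(U, V)] for the times [n] at which [T ^ n] maps some point
    of [U] into [V].
    Let [x] be a vector whose orbit visits every nonempty open set with positive
    upper Banach density; both kinds of hypercyclicity provide one.

    Weak mixing.  If [A] has positive upper Banach density, then among enough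
    translates of [A] two must meet ([banach_dense_diff]): the differences of
    [A] meet every set that contains all differences of arbitrarily long finite
    sequences.  When [W] is a neighbourhood of [0], the set [N(U, W)] contains
    arbitrarily long intervals, because [T 0 = 0], and [N(W, V)] contains a
    translate of the differences of some [N(x, O)].  So [N(U, W)] and [N(W, V)]
    meet ([three_open_sets]).  Adding a point that goes from [U] to [W] and one
    that goes from [W] to [V] gives [weakly_mixing]: finitely many pairs
    [(U i, V i)] always have a common transition time.

    Reiterative hypercyclicity.  By weak mixing and Baire's argument there is a
    tuple [y] whose orbit visits every box of open sets infinitely often.  Given
    a box [V], choose times [p i] with [T ^ (p i) x] in [V i].  The set of [m]
    with [T ^ (m + p i) x] in [V i] for all [i] fills a fixed proportion of
    arbitrarily long windows.  The orbit of [y] comes infinitely often so close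
    to the tuple of the [T ^ (s + p i) x], where [s] is the start of such a
    window, that it makes the same visits during the whole window.

    Upper frequent hypercyclicity.  Baire's argument now needs, for each box
    [V], a proportion of visits to [V] that is reached from every box [U], with
    no loss depending on [U] ([upper_dense_box]).  Let [A] be the set of [m] as
    above, of upper density at least [1 / q].  Out of [q * r] translates of
    [A], where [r] is the number of factors, some [r] have an intersection
    whose upper density is bounded below in terms of [q] and [r] alone
    ([upper_dense_shifts]).  So the translations [a k] may be adapted to [U]:
    weak mixing lets them be such that, whatever index [g k] is prescribed for
    each [k], some point visits [U (g k)] at time [p (g k) + a k]
    ([universal_times]).  Once pigeonhole has picked [r] translations, they are
    matched with the [r] factors, and the orbit of [x] enters the open set of
    such points. *)

Set Implicit Arguments.
Unset Strict Implicit.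
Unset Printing Implicit Defensive.

(** * Counting visits *)

Section counting.
Local Open Scope nat_scope.

Definition visits (A : set nat) (s N : nat) : nat :=
  \sum_(n < N) `[< A (s + n) >].

Lemma visits_cat (A : set nat) s M N :
  visits A s (M + N) = visits A s M + visits A (s + M) N.
Proof.
rewrite /visits big_split_ord/=; congr (_ + _).
by apply: eq_bigr => i _; rewrite addnA.
Qed.

Lemma visits_le (A : set nat) s N : visits A s N <= N.
Proof.
rewrite -[leqRHS]card_ord -sum1_card; apply: leq_sum => i _.
exact: leq_b1.
Qed.

Lemma visits_mono (A B : set nat) s t N :
  (forall n, n < N -> A (s + n) -> B (t + n)) -> visits A s N <= visits B t N.
Proof.
move=> AB; apply: leq_sum => i _.
by case: asboolP => // /AB -/(_ (ltn_ord i)) Bi; rewrite asboolT.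
Qed.

Lemma visits_shift (A : set nat) s a N : visits A s N <= a + visits A (s + a) N.
Proof.
apply: (@leq_trans (visits A s (a + N))).
  by rewrite addnC visits_cat leq_addr.
by rewrite visits_cat leq_add2r visits_le.
Qed.

(** [upper_dense q A] says that [A] has upper density at least [1 / q], and
    [banach_dense q A] that arbitrarily long windows contain the proportion
    [1 / q] of points of [A].  An integer [q] keeps the counting in [nat]. *)
Definition upper_dense (q : nat) (A : set nat) : Prop :=
  forall N0, exists2 N, N0 <= N & N <= q * visits A 0 N.

Definition banach_dense (q : nat) (A : set nat) : Prop :=
  forall N0, exists2 N, N0 <= N & exists s, N <= q * visits A s N.

Lemma upper_dense_banach q A : upper_dense q A -> banach_dense q A.
Proof. by move=> Aq N0; have [N N0N AN] := Aq N0; exists N => //; exists 0. Qed.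

Lemma banach_dense_unbounded q A (m : nat) :
  banach_dense q A -> exists2 n, m <= n & A n.
Proof.
move=> /(_ (q * m).+1)[N qmN [s Ns]].
have : m < visits A s N by nia.
move=> mv; apply: contrapT => /forall2NP noA; move: mv.
apply/negP; rewrite -leqNgt.
have : visits A s N <= visits [set n | n < m] 0 m.
  case: (leqP N m) => [Nm|/ltnW mN].
    rewrite (leq_trans (visits_le _ _ _))// (leq_trans Nm)//.
    rewrite /visits -[leqLHS]card_ord -sum1_card leq_sum// => i _.
    by rewrite asboolT//= add0n.
  rewrite -(subnKC mN) visits_cat -[leqRHS]addn0 leq_add//.
    apply: (leq_trans (visits_le _ _ _)).
    rewrite /visits -[leqLHS]card_ord -sum1_card leq_sum// => i _.
    by rewrite asboolT//= add0n.
  rewrite leqn0 /visits sum_nat_eq0; apply/forallP => i; apply/implyP => _.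
  case: asboolP => // Ai; have [/negP|//] := noA (s + m + i).
  by rewrite -addnA addnCA leq_addr.
by move/leq_trans; apply; exact: visits_le.
Qed.

Lemma upper_dense_shift q (A B : set nat) j :
  (forall n, A (j + n) -> B n) -> upper_dense q A -> upper_dense (2 * q) B.
Proof.
move=> AB Aq N0; have [N NN0 AN] := Aq (N0 + 2 * q * j).
exists N; first by lia.
have := visits_shift A 0 j N.
have : visits A (0 + j) N <= visits B 0 N.
  by apply: visits_mono => n _; rewrite !add0n; exact: AB.
nia.
Qed.

(** * Intersections of translates *)

Section shifts.
Variables (A : set nat) (q r : nat).
Hypothesis r0 : 0 < r.
Let K := q * r.
Variable a : 'I_K -> nat.

Definition common_shift (f : {ffun 'I_r -> 'I_K}) : set nat :=
  [set n | forall i, A (n + a (f i))].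

(** Either at most [r - 1] of the translates contain [n], or [r] of them do and
    [n] is counted by some injection [f]. *)
Lemma multiplicity_le n :
  \sum_(k < K) `[< A (n + a k) >] <=
  r.-1 + K * \sum_(f : {ffun 'I_r -> 'I_K} | injectiveb f)
                `[< common_shift f n >].
Proof.
pose S := [set k : 'I_K | `[< A (n + a k) >]]%SET.
have -> : \sum_(k < K) `[< A (n + a k) >] = #|S|.
  rewrite -sum1_card [RHS]big_mkcond/=.
  by apply: eq_bigr => k _; rewrite inE; case: asboolP.
have [Sr|rS] := ltnP #|S| r; first by rewrite (@leq_trans r.-1) ?leq_addr; lia.
pose f : {ffun 'I_r -> 'I_K} := [ffun i => enum_val (widen_ord rS i)].
have fI : injectiveb f.
  apply/injectiveP => i j; rewrite !ffunE => /enum_val_inj/(congr1 val)/=.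
  exact: val_inj.
have fA : common_shift f n.
  move=> i; rewrite ffunE; apply/asboolP.
  by have := enum_valP (widen_ord rS i); rewrite inE.
rewrite (bigD1 f)//= asboolT// mulnDr muln1.
apply: (@leq_trans K); last by rewrite addnCA leq_addr.
by rewrite -[leqRHS]card_ord max_card.
Qed.

(** Summing the multiplicities over a window counts each of the [q * r]
    translates with proportion [1 / q], up to the boundary error [L], so about
    [r * N] in all; points of multiplicity less than [r] account for at most
    [(r - 1) * N] of these. *)
Lemma pigeonhole s N L : (forall k, a k <= L) -> N <= q * visits A s N ->
  N <= K * (\sum_(f : {ffun 'I_r -> 'I_K} | injectiveb f)
                visits (common_shift f) s N + L).
Proof.
move=> aL NA; case: (posnP q) NA => [->|q0 NA]; first by rewrite mul0n; lia.
set S := \sum_(f | _) _.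
have mul_sum M c : M * c = \sum_(i < M) c by rewrite sum_nat_const card_ord.
have H1 : K * visits A s N <= \sum_(k < K) \sum_(n < N) `[< A (s + n + a k) >]
                              + K * L.
  rewrite !(mul_sum K) -big_split/=.
  apply: leq_sum => k _; rewrite addnC.
  apply: leq_trans (visits_shift _ _ (a k) _) _; rewrite leq_add//.
  by apply: leq_sum => n _; rewrite addnAC.
have H2 : \sum_(k < K) \sum_(n < N) `[< A (s + n + a k) >] <=
          r.-1 * N + K * S.
  rewrite exchange_big/= /S [in leqRHS]exchange_big/= mulnC (mul_sum N).
  rewrite big_distrr/= -big_split/=.
  by apply: leq_sum => n _; exact: multiplicity_le.
have H3 : K * N <= q * (r.-1 * N + K * S + K * L).
  apply: (leq_trans (leq_mul (leqnn K) NA)); rewrite mulnCA leq_mul2l.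
  by apply/orP; right; lia.
rewrite -(leq_pmul2l q0) mulnDr -(leq_add2l (q * (r.-1 * N))).
have -> : q * (r.-1 * N) + q * N = K * N.
  by rewrite -mulnDr addnC -mulSn prednK// mulnA.
by apply: leq_trans H3 _; rewrite !mulnDr !addnA.
Qed.

End shifts.

Lemma banach_dense_diff (A : set nat) (q : nat) (a : 'I_(q * 2) -> nat) :
  banach_dense q A ->
  exists k l : 'I_(q * 2), k != l /\ exists n, A (n + a k) /\ A (n + a l).
Proof.
move=> Aq; pose L := \max_k a k.
have aL k : a k <= L by exact: leq_bigmax.
have [N NL [s Ns]] := Aq ((q * 2) * L).+1.
have := pigeonhole (isT : 0 < 2) aL Ns.
set S := \sum_(f | _) _ => NS.
have : S != 0 by apply: contraTneq NL => S0; move: NS; rewrite S0; lia.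
rewrite /S sum_nat_eq0 => /forallPn[f].
rewrite negb_imply => /andP[/injectiveP fI].
rewrite /visits sum_nat_eq0 => /forallPn[n]; case: asboolP => // fn _.
exists (f ord0), (f (lift ord0 ord0)); split; first by rewrite (inj_eq fI).
by exists (s + n); split; exact: fn.
Qed.

(** A reciprocal, like [q]: the factor [2] absorbs the boundary error, [q * r]
    is the factor lost in [pigeonhole], and the last one shares the points
    between the injections. *)
Definition shift_density (q r : nat) : nat :=
  2 * (q * r) * #|{ffun 'I_r -> 'I_(q * r)}|.

(** The selected injection [f] depends on the window, but there are finitely
    many injections, so one of them serves arbitrarily long windows.  The bound
    does not involve the translations [a]. *)
Lemma upper_dense_shifts (A : set nat) (q r : nat) (a : 'I_(q * r) -> nat) :
  0 < q -> 0 < r -> upper_dense q A ->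
  exists f : {ffun 'I_r -> 'I_(q * r)}, injective f /\
    upper_dense (shift_density q r) (common_shift A a f).
Proof.
move=> q0 r0 Aq; pose L := \max_k a k.
have aL k : a k <= L by exact: leq_bigmax.
pose F : finType := {ffun 'I_r -> 'I_(q * r)}.
have F0 : 0 < #|F| by rewrite card_ffun !card_ord expn_gt0 muln_gt0 q0 r0.
have H N0 : exists f : F, injective f /\ exists2 N, N0 <= N &
    N <= shift_density q r * visits (common_shift A a f) 0 N.
  have [N NN0 NA] := Aq (N0 + 2 * (q * r * L)).+1.
  have NS := pigeonhole r0 aL NA.
  set S := \sum_(f | _) _ in NS.
  have DS : shift_density q r * S = #|F| * (2 * (q * r) * S).
    by rewrite /shift_density mulnAC mulnC.
  (* too few visits for each injection would contradict [pigeonhole] *)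
  apply: contrapT => /forallNP noF.
  have : shift_density q r * S <= #|F| * N.
    rewrite big_distrr/= big_mkcond/= -sum_nat_const leq_sum// => f _.
    case: ifPn => // /injectiveP fI.
    rewrite leqNgt; apply/negP => /ltnW Nf; apply: (noF f); split => //.
    by exists N => //; lia.
  by rewrite DS leq_pmul2l//; lia.
apply: contrapT => /forallNP noF.
have /choice[m mP] (f : F) : exists m, forall N, m <= N -> injective f ->
    ~ (N <= shift_density q r * visits (common_shift A a f) 0 N).
  have [fI|fNI] := pselect (injective f); last by exists 0.
  have := noF f; rewrite not_andP => -[//|/existsNP[m mP]].
  by exists m => N mN _ Nf; apply: mP; exists N.
have [f [fI [N mN Nf]]] := H (\max_f m f).
by apply: (mP f N _ fI Nf); apply: leq_trans mN; exact: leq_bigmax.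
Qed.

End counting.

(** * Densities as limits *)

Lemma card_itvE (A : set nat) a b : card_itv A a b = visits A a (b.+1 - a).
Proof.
pose s := [seq n <- index_iota a b.+1 | `[< A n >]].
have -> : card_itv A a b = size s.
  rewrite /card_itv (_ : A `&` _ = [set` [fset n in s]%fset]).
    by rewrite set_fsetK card_fseq undup_id// filter_uniq// iota_uniq.
  apply/seteqP; split => n /=; rewrite in_itv/= !inE mem_filter mem_index_iota.
    by move=> [An anb]; rewrite asboolT.
  by move=> /andP[/asboolP An anb]; split.
rewrite /s size_filter -sum1_count big_mkcond/=.
rewrite -{1}[a]add0n big_addn big_mkord; apply: eq_bigr => i _.
by rewrite addnC; case: asboolP.
Qed.

Section limn_sup.
Variables (R : realType) (u : R^o^nat) (M : R).
Hypotheses (u0 : forall n, 0 <= u n) (uM : forall n, u n <= M).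

Lemma between_bounded_fun : bounded_fun u.
Proof.
exists M; split; first exact: num_real.
by move=> x Mx n _ /=; rewrite ger0_norm// (le_trans (uM n))// ltW.
Qed.

Lemma limn_sup_often l : l < limn_sup u ->
  forall n, exists2 m, (n <= m)%N & l < u m.
Proof.
rewrite limn_supE; last exact: between_bounded_fun.
move=> lu n; have : l < sups u n.
  apply: (lt_le_trans lu); apply: ge_inf; last by exists n.
  exact/bounded_fun_has_lbound_sups/between_bounded_fun.
by move=> /sup_gt[|_ [m/= nm <-] lm]; [exists (u n), n => /= | exists m].
Qed.

Lemma often_limn_sup l :
  (forall n, exists2 m, (n <= m)%N & l <= u m) -> l <= limn_sup u.
Proof.
move=> lu; rewrite limn_supE; last exact: between_bounded_fun.
apply: lb_le_inf; first by exists (sups u 0%N), 0%N.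
move=> _ [n _ <-]; have [m nm lm] := lu n; apply: (le_trans lm).
apply: ub_le_sup; last by exists m.
exact/has_ubound_sdrop/bounded_fun_has_ubound/between_bounded_fun.
Qed.

End limn_sup.

Lemma upper_density_gt0P (R : realType) (A : set nat) :
  0 < upper_density R A <-> exists2 q, (0 < q)%N & upper_dense q A.
Proof.
pose u (N : nat) : R^o := (card_itv A 0 N)%:R / N.+1%:R.
have u0 N : 0 <= u N by rewrite divr_ge0.
have u1 N : u N <= 1.
  by rewrite ler_pdivrMr// mul1r ler_nat card_itvE subn0 visits_le.
split=> [A0|[q q0 Aq]].
  have A2 : 0 < upper_density R A / 2 by rewrite divr_gt0.
  pose q := (Num.truncn (upper_density R A / 2)^-1).+1.
  exists q => // N0.
  have [|N NN0] := @limn_sup_often R u 1 u0 u1 (upper_density R A / 2) _ N0.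
    by rewrite /upper_density -/u in A0 *; lra.
  rewrite /u card_itvE subn0 ltr_pdivlMr// => AN.
  exists N.+1; first exact: leqW.
  rewrite -(ler_nat R) natrM -ler_pdivrMl ?ltr0n//.
  apply: ltW; apply: le_lt_trans AN; rewrite ler_wpM2r//.
  by rewrite -[leRHS]invrK lef_pV2 ?posrE ?invr_gt0// ltW// truncnS_gt.
apply: (@lt_le_trans _ _ q%:R^-1); first by rewrite invr_gt0 ltr0n.
apply: (@often_limn_sup R u 1 u0 u1) => n; have [N nN AN] := Aq n.+1.
exists N.-1; first by lia.
rewrite /u card_itvE subn0 prednK; last by lia.
rewrite ler_pdivlMr ?ltr0n ?(leq_trans _ nN)//.
by rewrite ler_pdivrMl ?ltr0n// -natrM ler_nat.
Qed.

Section fekete.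
Variables (R : realType) (u : nat -> R).
Hypotheses (u0 : forall n, 0 <= u n) (un : forall n, u n <= n%:R).
Hypothesis uD : forall m n, u (m + n)%N <= u m + u n.

(** Fekete's lemma.  If [u m / m] is close to the infimum, then dividing [n] by
    [m] bounds [u n / n] by [u m / m] plus the contribution [m / n] of the
    remainder. *)
Lemma fekete : (fun n => u n / n%:R : R^o) @ \oo -->
  inf [set u n / n%:R | n in [set n | (0 < n)%N]].
Proof.
set S := [set _ | _ in _]; have Sge0 : lbound S 0.
  by move=> _ [n n0 <-]; rewrite divr_ge0.
have uM k m : u (k * m)%N <= k%:R * u m.
  elim: k => [|k IH]; first by rewrite mul0n mul0r.
  rewrite mulSn (le_trans (uD _ _))// -addn1 natrD mulrDl mul1r addrC.
  by rewrite lerD2r.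
apply/cvgrPdist_le => e e0.
have [||_ [m /= m0 <-] um] := @inf_lt _ S (inf S + e / 2).
- by exists (u 1%N / 1), 1%N.
- by rewrite ltrDl divr_gt0.
pose C := Num.truncn (m%:R / (e / 2)).
exists C.+1 => //= n Cn.
have n0 : 0 < n%:R :> R by rewrite ltr0n; apply: leq_trans Cn.
have infn : inf S <= u n / n%:R.
  by apply: ge_inf; [exists 0 | exists n => //=; rewrite -(ltr0n R)].
rewrite ler0_norm ?subr_le0// opprB lerBlDr.
have Cm : m%:R / n%:R <= e / 2.
  rewrite ler_pdivrMr// mulrC -ler_pdivrMr ?divr_gt0// ltW//.
  by rewrite (lt_le_trans (truncnS_gt _))// ler_nat.
have mR : 0 < m%:R :> R by rewrite ltr0n.
suff : u n / n%:R <= u m / m%:R + m%:R / n%:R by move: um Cm; lra.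
rewrite {1}(divn_eq n m) ler_pdivrMr// mulrDl divfK ?gt_eqF//.
rewrite (le_trans (uD _ _))// lerD//.
  rewrite (le_trans (uM _ _))// mulrC -mulrA ler_wpM2l//.
  by rewrite mulrC ler_pdivlMr// -natrM ler_nat leq_trunc_div.
by rewrite (le_trans (un _))// ler_nat ltnW// ltn_mod.
Qed.

End fekete.

Section banach.
Variables (R : realType) (A : set nat).

Let count N : R^o^nat := fun k => (card_itv A (k + 1)%N (k + N)%N)%:R.

Let countE N k : count N k = (visits A k.+1 N)%:R.
Proof. by rewrite /count card_itvE addn1 subSS addKn. Qed.

Let count_ge0 N k : 0 <= count N k. Proof. by []. Qed.

Let count_le N k : count N k <= N%:R.
Proof. by rewrite countE ler_nat visits_le. Qed.

Lemma banach_count_ge0 N : 0 <= banach_count R A N.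
Proof.
apply: (@often_limn_sup R (count N) N%:R (count_ge0 N) (count_le N)) => n.
by exists n.
Qed.

Lemma banach_count_le N : banach_count R A N <= N%:R.
Proof.
rewrite leNgt; apply/negP.
move=> /(limn_sup_often (count_ge0 N) (count_le N))/(_ 0%N)[k _].
by rewrite ltNge count_le.
Qed.

Lemma banach_countD M N :
  banach_count R A (M + N) <= banach_count R A M + banach_count R A N.
Proof.
pose v k := count N (k + M)%N.
have v0 k : 0 <= v k := count_ge0 _ _.
have vN k : v k <= N%:R := count_le _ _.
have -> : banach_count R A (M + N) = limn_sup (count M \+ v).
  congr limn_sup; apply/funext => k; rewrite /v/= -/(count _ _) !countE.
  by rewrite visits_cat natrD addSn.
have := le_limn_supD (between_bounded_fun (count_ge0 M) (count_le M))
  (between_bounded_fun v0 vN).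
move=> /le_trans; apply; rewrite lerD2l.
rewrite leNgt; apply/negP => h.
have [l /andP[lN lv]] : exists l, banach_count R A N < l < limn_sup v.
  by exists ((banach_count R A N + limn_sup v) / 2); rewrite midf_lt//= midf_lt.
move: lN; apply/negP; rewrite -leNgt.
apply: (often_limn_sup (count_ge0 N) (count_le N)) => n.
have [m nm lm] := limn_sup_often v0 vN lv n.
by exists (m + M)%N; [rewrite (leq_trans nm)// leq_addr | exact: ltW].
Qed.

Let B := [set banach_count R A n / n%:R | n in [set n | (0 < n)%N]].

Lemma upper_banach_densityE : upper_banach_density R A = inf B.
Proof.
apply/cvg_lim => //.
exact: (fekete banach_count_ge0 banach_count_le banach_countD).
Qed.

Lemma upper_banach_density_dense : 0 < upper_banach_density R A ->
  exists2 q, (0 < q)%N & banach_dense q A.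
Proof.
rewrite upper_banach_densityE; set d := inf B => d0.
exists (Num.truncn (d / 2)^-1).+1 => // N0; exists N0.+1 => //.
have dN : d <= banach_count R A N0.+1 / N0.+1%:R.
  apply: ge_inf; last by exists N0.+1.
  by exists 0 => _ [n _ <-]; rewrite divr_ge0// banach_count_ge0.
have := limn_sup_often (count_ge0 N0.+1) (count_le N0.+1).
move=> /(_ (d / 2 * N0.+1%:R))/(_ _ 0%N)[|k _].
  apply: (@lt_le_trans _ _ (d * N0.+1%:R)).
    by rewrite ltr_pM2r// ltr_pdivrMr// mulrDr mulr1 ltrDl.
  by rewrite -ler_pdivlMr.
rewrite countE => dk; exists k.+1; rewrite -(ler_nat R) natrM -ler_pdivrMl//.
apply: ltW; apply: le_lt_trans dk; rewrite ler_wpM2r//.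
by rewrite -[leRHS]invrK lef_pV2 ?posrE ?invr_gt0 ?divr_gt0// ltW// truncnS_gt.
Qed.

Lemma often_upper_banach_density q :
  (forall N0, exists2 N, (N0 <= N)%N &
     forall s0, exists2 s, (s0 <= s)%N & (N <= q * visits A s N)%N) ->
  0 < upper_banach_density R A.
Proof.
move=> Aq; have q0 : (0 < q)%N.
  by have [N N1 /(_ 0%N)[s _]] := Aq 1%N; lia.
apply: (@lt_le_trans _ _ q%:R^-1); first by rewrite invr_gt0 ltr0n.
rewrite upper_banach_densityE leNgt; apply/negP => Bq.
have := fekete banach_count_ge0 banach_count_le banach_countD.
move=> /cvgr_lt/(_ _ Bq)[N0 _ N0q].
have [N N0N qN] := Aq N0.+1.
have NR : 0 < N%:R :> R by rewrite ltr0n; lia.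
have /= := N0q N (ltnW N0N); apply/negP; rewrite -leNgt ler_pdivlMr// mulrC.
apply: (often_limn_sup (count_ge0 N) (count_le N)) => s0.
have [[|s] s0s Ns] := qN s0.+1; first by [].
by exists s => //; rewrite countE ler_pdivrMr ?ltr0n// -natrM ler_nat mulnC.
Qed.

End banach.

(** * Weak mixing *)

Lemma open_forall (I : finType) (X : topologicalType) (U : I -> set X) :
  (forall i, open (U i)) -> open [set z | forall i, U i z].
Proof.
move=> oU; rewrite openE => z Uz; apply: filter_forall => i.
exact: open_nbhs_nbhs.
Qed.

Lemma iter_continuous (X : topologicalType) (T : X -> X) n :
  continuous T -> continuous (iter n T).
Proof.
move=> cT; elim: n => [|n IH] z /=; first exact: cvg_id.
exact: continuous_comp (IH z) (cT _).
Qed.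

Lemma open_iter (X : topologicalType) (T : X -> X) (U : set X) n :
  continuous T -> open U -> open [set z | U (iter n T z)].
Proof. by move=> cT; move: U; apply/continuousP; exact: iter_continuous. Qed.

Lemma open_add_split (K : numFieldType) (X : normedModType K) (U : set X) u :
  open U -> U u -> exists V W : set X,
    [/\ open V /\ V u, open W /\ W 0 & forall v w, V v -> W w -> U (v + w)].
Proof.
move=> oU Uu; have : nbhs (u + 0) U by rewrite addr0; exact: open_nbhs_nbhs.
move=> /(@add_continuous _ (u, 0))[[/= P Q] [Pu Q0] PQ].
exists P°, Q°; split; first by split => //; exact: open_interior.
  by split => //; exact: open_interior.
move=> v w /interior_subset Pv /interior_subset Qw.
exact: (PQ (v, w)).
Qed.

Definition hits (X : Type) (T : X -> X) (U V : set X) : set nat :=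
  [set n | exists2 z, U z & V (iter n T z)].

(** Each term is chosen far beyond the previous ones, where [P] holds on an
    interval long enough to contain all the new differences. *)
Lemma separated_sequence (P : nat -> Prop) (N : nat) :
  (forall L, exists t, forall l, (l <= L)%N -> (l < t)%N /\ P (t - l)%N) ->
  exists a : 'I_N -> nat, forall i j : 'I_N, (i < j)%N ->
    (a i < a j)%N /\ P (a j - a i)%N.
Proof.
move=> /choice[g gP]; pose a (i : nat) := iter i g 0%N.
have a_le i j : (i <= j)%N -> (a i <= a j)%N.
  move=> /subnK <-; elim: (j - i)%N => // d IH.
  rewrite addSn (leq_trans IH)// ltnW//=.
  by have [] := gP _ _ (leqnn (a (d + i)%N)).
exists (fun i => a i) => i [[|j] jN]//= ij; exact: gP (a_le _ _ _).
Qed.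

Section mixing.
Variables (K : numFieldType) (X : normedModType K) (T : {linear X -> X}).
Hypothesis cT : continuous T.
Variable x : X.
Hypothesis xT : forall U : set X, open U -> U !=set0 ->
  exists q, banach_dense q (return_set T x U).

Lemma orbit_often (U : set X) m :
  open U -> U !=set0 -> exists2 n, (m <= n)%N & U (iter n T x).
Proof.
by move=> oU U0; have [q /banach_dense_unbounded] := xT oU U0; exact.
Qed.

Lemma iter_linear0 n : iter n T 0 = 0.
Proof. by elim: n => //= n ->; exact: linear0. Qed.

Lemma iter_linearD n u v : iter n T (u + v) = iter n T u + iter n T v.
Proof. by elim: n => //= n ->; exact: linearD. Qed.

(** A point that enters a small enough neighbourhood of the fixed point [0]
    stays in [W] for the next [L] steps. *)
Lemma hits0_thick (U W : set X) L : open U -> U !=set0 -> open W -> W 0 ->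
  exists t, forall l, (l <= L)%N -> hits T U W (t + l)%N.
Proof.
move=> oU U0 oW W0.
pose O := [set z | forall l : 'I_L.+1, W (iter l T z)].
have oO : open O by apply: open_forall => l; exact: open_iter.
have O0 : O !=set0 by exists 0 => l; rewrite iter_linear0.
have [a _ Ua] := orbit_often 0 oU U0.
have [m am Om] := orbit_often a oO O0.
exists (m - a)%N => l; rewrite -ltnS => lL; exists (iter a T x) => //.
rewrite -iterD addnAC subnK// addnC iterD.
exact: Om (Ordinal lL).
Qed.

(** If [x] visits [O] at times [m < m'], then [T ^ m x] is in [W] and reaches
    [V] after [m' - m + p] steps; the times [a] make all such durations
    transition times from [U] to [W]. *)
Lemma three_open_sets (U V W : set X) : open U -> U !=set0 ->
  open V -> V !=set0 -> open W -> W 0 ->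
  exists n, hits T U W n /\ hits T W V n.
Proof.
move=> oU U0 oV V0 oW W0.
have [b _ Wb] := orbit_often 0 oW (ex_intro _ 0 W0).
have [c bc Vc] := orbit_often b oV V0.
pose p := (c - b)%N; pose O := W `&` [set z | V (iter p T z)].
have oO : open O by apply: openI => //; exact: open_iter.
have [q Oq] : exists q, banach_dense q (return_set T x O).
  apply: xT => //; exists (iter b T x); split => //=.
  by rewrite -iterD subnK.
have [a aP] : exists a : 'I_(q * 2) -> nat, forall i j : 'I_(q * 2),
    (i < j)%N -> (a i < a j)%N /\ hits T U W (a j - a i + p)%N.
  apply: (@separated_sequence [set n | hits T U W (n + p)%N]) => L.
  have [t tP] := hits0_thick (L.+1 + p) oU U0 oW W0.
  exists (t + L).+1 => l lL; split; first by lia.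
  rewrite /= (_ : _ + p = t + (L.+1 - l + p))%N; last by lia.
  by apply: tP; lia.
have [i [j [ij [n [Oi Oj]]]]] := banach_dense_diff a Oq.
wlog ij' : i j ij Oi Oj / (i < j)%N.
  move=> H; have [?|?|/val_inj E] := ltngtP i j; first exact: (H i j).
    by apply: (H j i) => //; rewrite eq_sym.
  by rewrite E eqxx in ij.
have [aij UW] := aP i j ij'.
exists (a j - a i + p)%N; split=> //.
exists (iter (n + a i) T x); first by have [] := Oi.
have [_] := Oj; rewrite /= -!iterD.
by congr (V (iter _ T x)); lia.
Qed.

(** The orbit of [x] visits each [U i] and each [V i], at times [a i] and [b i],
    so the preimages of all the [U i] under [T ^ (a i)] have the point [x] in
    common, and likewise for the [V i].  A single application of
    [three_open_sets] to these two intersections, with a transition point [u]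
    of the first and [w] of the second, then treats all pairs at once through
    the points [T ^ (a i) u + T ^ (b i) w]. *)
Lemma weakly_mixing (I : finType) (U V : I -> set X) m :
  (forall i, open (U i)) -> (forall i, U i !=set0) ->
  (forall i, open (V i)) -> (forall i, V i !=set0) ->
  exists2 n, (m <= n)%N & forall i, hits T (U i) (V i) n.
Proof.
move=> oU U0; wlog -> : m V / m = 0%N.
  move=> H oV V0.
  have [| | |n _ nP] := H 0%N (fun i => [set z | V i (iter m T z)]).
  - by [].
  - by move=> i; exact: open_iter.
  - move=> i; have [c mc Vc] := orbit_often m (oV i) (V0 i).
    by exists (iter (c - m) T x) => /=; rewrite -iterD subnKC.
  exists (m + n)%N; first exact: leq_addr.
  by move=> i; have [z Uz Vz] := nP i; exists z; rewrite ?iterD.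
move=> oV V0.
(* room is left in [U i] and [V i] for adding a vector close to [0] *)
have /choice[a aU] i : exists n, U i (iter n T x).
  by have [n _ Un] := orbit_often 0 (oU i) (U0 i); exists n.
have /choice[b bV] i : exists n, V i (iter n T x).
  by have [n _ Vn] := orbit_often 0 (oV i) (V0 i); exists n.
have /choice[U' /choice[WU UP]] i := open_add_split (oU i) (aU i).
have /choice[V' /choice[WV VP]] i := open_add_split (oV i) (bV i).
pose W := [set z | forall i, (WU i (iter (b i) T z) /\ WV i (iter (a i) T z))].
have oW : open W.
  apply: open_forall => i; apply: openI; apply: open_iter => //.
    by have [_ []] := UP i.
  by have [_ []] := VP i.
have W0 : W 0.
  by move=> i; rewrite !iter_linear0; have [_ [_ ?] _] := UP i;
     have [_ [_ ?] _] := VP i.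
have oU' : open [set z | forall i, U' i (iter (a i) T z)].
  by apply: open_forall => i; apply: open_iter => //; have [[]] := UP i.
have oV' : open [set z | forall i, V' i (iter (b i) T z)].
  by apply: open_forall => i; apply: open_iter => //; have [[]] := VP i.
have [n [[u Uu Wu] [w Ww Vw]]] : exists n,
    hits T [set z | forall i, U' i (iter (a i) T z)] W n /\
    hits T W [set z | forall i, V' i (iter (b i) T z)] n.
  by apply: three_open_sets => //; exists x => i;
    [have [[]] := UP i | have [[]] := VP i].
exists n => // i; exists (iter (a i) T u + iter (b i) T w).
  by have [_ _] := UP i; apply=> //; have [] := Ww i.
rewrite iter_linearD addrC -!iterD ![(n + _)%N]addnC !iterD.
by have [_ _] := VP i; apply=> //; have [] := Wu i.
Qed.

End mixing.

(** * Upper frequent visits to a box, from every box *)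

Section upper_orbits.
Variables (K : numFieldType) (X : normedModType K) (T : {linear X -> X}).
Hypothesis cT : continuous T.
Variable x : X.
Hypothesis xT : forall U : set X, open U -> U !=set0 ->
  exists q, banach_dense q (return_set T x U).

(** A new time [n] must let every admissible pattern [g] be extended by every
    index [i]: finitely many pairs of open sets, so weak mixing applies. *)
Lemma universal_times (I : finType) (U : I -> set X) N :
  (forall i, open (U i)) -> (forall i, U i !=set0) ->
  exists a : 'I_N -> nat, forall g : {ffun 'I_N -> I},
    exists z, forall k, U (g k) (iter (a k) T z).
Proof.
move=> oU U0; elim: N => [|N [a aP]].
  by exists (fun=> 0%N) => g; exists 0 => -[].
pose O (g : {ffun 'I_N -> I}) := [set z | forall k, U (g k) (iter (a k) T z)].
have [||||n _ nP] := @weakly_mixing _ _ T cT x xT ({ffun 'I_N -> I} * I)%type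
    (fun p => O p.1) (fun p => U p.2) 0.
- by move=> p; apply: open_forall => k; exact: open_iter.
- by move=> p; exact: aP.
- by move=> p; exact: oU.
- by move=> p; exact: U0.
exists (fun k => oapp a n (unlift ord_max k)) => g.
have [z /= Oz Uz] := nP ([ffun k => g (lift ord_max k)], g ord_max).
by exists z => k; case: unliftP => [k' ->|->] //=; have := Oz k'; rewrite ffunE.
Qed.

(** The translations depend on [U], the density only on [V].  The point [y i] is
    [T ^ (p i + a (k i) + j) x]: the time [j] brings [x] to a point with
    prescribed visits to the [U i], and shifting by [j] does not affect the
    upper density. *)
Lemma upper_dense_box (I : finType) (V : I -> set X) :
  (0 < #|I|)%N ->
  (forall U : set X, open U -> U !=set0 ->
    exists2 q, (0 < q)%N & upper_dense q (return_set T x U)) ->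
  (forall i, open (V i)) -> (forall i, V i !=set0) ->
  exists q, forall U : I -> set X,
    (forall i, open (U i)) -> (forall i, U i !=set0) ->
    exists2 y : I -> X, forall i, U i (y i) &
      upper_dense q [set n | forall i, V i (iter n T (y i))].
Proof.
move=> I0 xU oV V0.
have /choice[p pV] i : exists n, V i (iter n T x).
  by have [n _ Vn] := orbit_often xT 0 (oV i) (V0 i); exists n.
pose W := [set z | forall i, V i (iter (p i) T z)].
have [q q0 Aq] : exists2 q, (0 < q)%N & upper_dense q (return_set T x W).
  apply: xU; last by exists x.
  by apply: open_forall => i; exact: open_iter.
exists (2 * shift_density q #|I|)%N => U oU U0.
have [||a aU] := @universal_times I (fun i => [set z | U i (iter (p i) T z)])
  (q * #|I|)%N.
- by move=> i; exact: open_iter.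
- move=> i; have [c pc Uc] := orbit_often xT (p i) (oU i) (U0 i).
  by exists (iter (c - p i) T x) => /=; rewrite -iterD subnKC.
have [f [fI fA]] := upper_dense_shifts a q0 I0 Aq.
have /card_gt0P[i0 _] := I0.
pose k i := f (enum_rank i).
have kI : injective k by move=> i i' /fI/enum_rank_inj.
(* the index prescribed at time [k i] is [i]; it does not matter elsewhere *)
have [z zU] := aU [ffun l => odflt i0 [pick i | k i == l]].
have {}zU i : U i (iter (p i) T (iter (a (k i)) T z)).
  have := zU (k i); rewrite ffunE; case: pickP => [i' /eqP/kI ->//|/(_ i)].
  by rewrite eqxx.
have [j _ xj] : exists2 j, (0 <= j)%N &
    forall i, U i (iter (p i) T (iter (a (k i)) T (iter j T x))).
  apply: (orbit_often xT (U :=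
    [set z | forall i, U i (iter (p i) T (iter (a (k i)) T z))])).
    2: by exists z.
  apply: open_forall => i.
  apply: (@open_iter _ T [set w | U i (iter (p i) T w)] _ cT).
  exact: open_iter.
exists (fun i => iter (p i) T (iter (a (k i)) T (iter j T x))) => //.
apply: (@upper_dense_shift _ _ _ j _ fA) => n nA i; have := nA (enum_rank i) i.
rewrite -!iterD; congr (V i (iter _ T x)).
by rewrite -/(k i); lia.
Qed.

End upper_orbits.

(** * Baire's argument for boxes *)

(** Baire's theorem in a finite power of [X], with density and openness replaced
    by the only property used: every open box contains an open box inside [G j].
    The nested balls have radii [1 / (m + 1)], which avoids taking minima in
    [K]: its order is partial when [K] is the field of complex numbers. *)
Lemma box_baire (K : numFieldType) (X : completeNormedModType K) (I : finType)
    (J : countType) (G : J -> set (I -> X)) :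
  (forall e : K, 0 < e -> exists m, m.+1%:R^-1 < e) ->
  (forall j (U : I -> set X),
    (forall i, open (U i)) -> (forall i, U i !=set0) ->
    exists V : I -> set X,
      [/\ forall i, open (V i), forall i, V i !=set0, forall i, V i `<=` U i &
          forall y, (forall i, V i (y i)) -> G j y]) ->
  exists y, forall j, G j y.
Proof.
move=> archi dG.
have i0 m : 0 < m.+1%:R^-1 :> K by rewrite invr_gt0 ltr0n.
pose P (n : nat) (s t : (I -> X) * nat) :=
  [/\ forall i, ball (t.1 i) (2 * t.2.+1%:R^-1) `<=` ball (s.1 i) s.2.+1%:R^-1,
      (n <= t.2)%N &
      forall j : J, choice.pickle j = n -> forall y,
        (forall i, ball (t.1 i) (2 * t.2.+1%:R^-1) (y i)) -> G j y].
have step (u : nat * ((I -> X) * nat)) : exists t, P u.1 u.2 t.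
  case: u => n [c m] /=.
  have oB i : open (ball (c i) (m.+1%:R^-1 : K)) by exact: ball_open.
  have B0 i : ball (c i) (m.+1%:R^-1 : K) !=set0.
    by exists (c i); exact: ballxx.
  have [V [oV V0 VB VG]] : exists V : I -> set X,
      [/\ forall i, open (V i), forall i, V i !=set0,
          forall i, V i `<=` ball (c i) (m.+1%:R^-1 : K) &
          forall j : J, choice.pickle j = n ->
            forall y, (forall i, V i (y i)) -> G j y].
    case En : (@choice.unpickle J n) => [j|].
      have [V [oV V0 VB VG]] := dG j _ oB B0.
      exists V; split=> [||i|j' jn] //.
      by move: En; rewrite -jn choice.pickleK => -[->].
    exists (fun i => ball (c i) m.+1%:R^-1); split=> [||i|j jn] //.
    by move: En; rewrite -jn choice.pickleK.
  have /choice[c' c'V] := V0.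
  have /choice[h hV] i : exists h, ball (c' i) (h.+1%:R^-1 : K) `<=` V i.
    have /nbhs_ballP[e /= e0 eV] := open_nbhs_nbhs (conj (oV i) (c'V i)).
    have [h he] := archi e e0; exists h.
    by apply: subset_trans eV; apply: le_ball; exact: ltW.
  (* twice the radius still fits in every [V i], because the limit of the
     centers is only known to be in the closure of the smaller balls *)
  pose m' := (2 * (\max_i h i).+1 + n)%N.
  have m'V i : ball (c' i) (2 * m'.+1%:R^-1) `<=` V i.
    apply: subset_trans (hV i); apply: le_ball.
    rewrite ler_pdivrMr ?ltr0n// mulrC ler_pdivlMr ?ltr0n// -natrM ler_nat.
    by have := @leq_bigmax _ h i; rewrite /m'; lia.
  exists (c', m'); split=> /=.
  - by move=> i; apply: subset_trans (m'V i) (VB i).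
  - by rewrite /m' leq_addl.
  - by move=> j jn y yB; apply: (VG j jn) => i; exact/m'V/yB.
have [f fP] := choice step.
pose fix s n := if n is n'.+1 then f (n', s n') else (fun=> 0, 0%N).
have sP n : P n (s n) (s n.+1) by exact: (fP (n, s n)).
pose r n : K := (s n).2.+1%:R^-1.
have nested n k i : (n <= k)%N ->
    ball ((s k).1 i) (r k) `<=` ball ((s n).1 i) (r n).
  move=> /subnK <-; elim: (k - n)%N => // d IH; rewrite addSn.
  apply: subset_trans IH; have [+ _ _] := sP (d + n)%N.
  move=> /(_ i); apply: subset_trans; apply: le_ball.
  by rewrite ler_peMl ?ler1n // ltW // i0.
have center n k i : (n <= k)%N -> ball ((s n).1 i) (r n) ((s k).1 i).
  by move=> /nested; apply; exact: (ballxx _ (i0 _)).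
have /choice[l lP] i : exists l : X, (fun n => (s n).1 i) @ \oo --> l.
  apply/cvg_ex.
  apply: cauchy_cvg; apply: cauchy_exP => e e0.
  have [m me] := archi e e0.
  exists ((s m.+1).1 i), m.+1 => // k mk.
  apply: (@le_ball _ _ _ (r m.+1)); last exact: center.
  apply: (le_trans _ (ltW me)); rewrite lef_pV2 ?posrE ?ltr0n// ler_nat.
  by have [_ ? _] := sP m.
exists l => j; have [_ _] := sP (choice.pickle j); apply=> // i.
set n := (choice.pickle j).+1.
have [N _ Nl] : \forall k \near \oo, ball (l i) (r n) ((s k).1 i).
  by apply: (lP i); exact: (nbhsx_ballx _ _ (i0 _)).
rewrite mulrDl mul1r; apply: (@ball_triangle _ _ ((s (n + N)%N).1 i)).
  by apply: center; exact: leq_addr.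
by apply: ball_sym; apply: Nl; exact: leq_addl.
Qed.

Lemma countable_base (K : numFieldType) (X : normedModType K) :
  (forall e : K, 0 < e -> exists m, m.+1%:R^-1 < e) ->
  separable_space X ->
  exists B : nat * nat -> set X,
    (forall k, open (B k) /\ B k !=set0) /\
    forall U, open U -> U !=set0 -> exists k, B k `<=` U.
Proof.
move=> archi [D Dc Dd].
have i0 m : 0 < m.+1%:R^-1 :> K by rewrite invr_gt0 ltr0n.
have [d dD] : exists d : nat -> X, D `<=` range d.
  move: Dc => /pfcard_geP[->|[g]]; first by exists (fun=> 0).
  by exists g; exact: 'surj_g.
exists (fun k => ball (d k.1) k.2.+1%:R^-1); split=> [k|U oU [u Uu]].
  by split; [exact: ball_open | exists (d k.1); exact: ballxx].
have /nbhs_ballP[e /= e0 eU] := open_nbhs_nbhs (conj oU Uu).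
have [m me] := archi _ (divr_gt0 e0 (ltr0n K 2)).
have [y [+ /dD[k _ dk]]] := Dd (ball u m.+1%:R^-1)
  (ex_intro _ u (ballxx u (i0 m))) (ball_open u _).
rewrite -dk => uk; exists (k, m) => /= z dz; apply: eU.
apply: (@le_ball _ _ u (m.+1%:R^-1 + m.+1%:R^-1)).
  by rewrite [e]splitr lerD// ltW.
exact: ball_triangle uk dz.
Qed.

(** The boxes around [y] generate a filter that converges to [y] in every
    coordinate, hence in the product topology. *)
Lemma open_ptws_box (I : eqType) (X : topologicalType) (U : set {ptws I -> X})
    (y : I -> X) : open U -> U y ->
  exists V : I -> set X, (forall i, open (V i) /\ V i (y i)) /\
    forall z, (forall i, V i (z i)) -> U z.
Proof.
move=> oU Uy.
pose F : set_system (I -> X) :=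
  filter_from [set V : I -> set X | forall i, open (V i) /\ V i (y i)]
              (fun V => [set z | forall i, V i (z i)]).
have FF : Filter F.
  apply: filter_from_filter.
    by exists (fun=> setT) => i; split => //; exact: openT.
  move=> V W VP WP; exists (fun i => V i `&` W i) => [i|z zVW].
    have [oV Vy] := VP i; have [oW Wy] := WP i.
    by split=> //; exact: openI.
  by split=> i; have [] := zVW i.
have : F --> (y : {ptws I -> X}).
  apply/cvg_sup => i A; rewrite nbhsE => -[B [[C oC <-] Cy] BA].
  exists (fun j => if j == i then C else setT).
    by move=> j; case: eqP => [->|_]; split=> //; exact: openT.
  by move=> z /(_ i); rewrite eqxx => Cz; exact: BA.
by move=> /(_ U (open_nbhs_nbhs (conj oU Uy)))[V VP VU]; exists V.
Qed.

Lemma scalars_archimedean (R : realType) k (e : scalars R k) :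
  0 < e -> exists m, m.+1%:R^-1 < e.
Proof.
case: k e => /= e e0.
  exists (Num.truncn e^-1).
  by rewrite -[ltRHS]invrK ltf_pV2 ?posrE ?invr_gt0 ?ltr0n// truncnS_gt.
have eE : e = (complex.Re e)%:C%C by rewrite RRe_real// gtr0_real.
have Re0 : 0 < complex.Re e by move: e0; rewrite eE ltcR.
exists (Num.truncn (complex.Re e)^-1).
rewrite eE -(rmorph_nat (real_complex R)) -fmorphV ltcR.
by rewrite -[ltRHS]invrK ltf_pV2 ?posrE ?invr_gt0 ?ltr0n// truncnS_gt.
Qed.

(** * Products *)

Lemma iter_prod_map (X : Type) (T : X -> X) n m (y : 'I_n -> X) i :
  iter m (@prod_map X n T) y i = iter m T (y i).
Proof. by elim: m => //= m IH; rewrite /prod_map IH. Qed.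

(** Repeating from time [0] on the visits that [y i] makes to [V i] during the
    window of length [N] that starts at [s] amounts to finitely many conditions
    on [z], each of them open or void. *)
Lemma open_shadowing (I : finType) (X : topologicalType) (T : X -> X)
    (V : I -> set X) (y : I -> X) N s i :
  continuous T -> (forall i, open (V i)) ->
  open [set z | forall n : 'I_N, V i (iter (s + n)%N T (y i)) ->
                 V i (iter n T z)].
Proof.
move=> cT oV.
suff oS (n : 'I_N) : open [set z |
    V i (iter (s + n)%N T (y i)) -> V i (iter n T z)] by exact: open_forall.
have [Vy|nVy] := pselect (V i (iter (s + n)%N T (y i))).
  rewrite (_ : mkset _ = [set z | V i (iter n T z)]); first exact: open_iter.
  by apply/seteqP; split => z //= /(_ Vy).
rewrite (_ : mkset _ = setT); first exact: openT.
by apply/seteqP; split => z //= _ /nVy.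
Qed.

Section products.
Variables (R : realType) (K : numFieldType) (X : completeNormedModType K).
Hypothesis archi : forall e : K, 0 < e -> exists m, m.+1%:R^-1 < e.
Hypothesis X_separable : separable_space X.
Variable T : {linear X -> X}.
Hypothesis cT : continuous T.
Variable n : nat.

(** For each box of a countable base and each [N0], having the right proportion
    of visits on some window longer than [N0] is a condition on a finite piece
    of the orbit, so it is stable on a small box. *)
Lemma U_frequently_hypercyclic_prod : (0 < n)%N ->
  U_frequently_hypercyclic R (T : X -> X) ->
  U_frequently_hypercyclic R (@prod_map X n T).
Proof.
move=> n0 [x xT].
have xU (U : set X) : open U -> U !=set0 ->
    exists2 q, (0 < q)%N & upper_dense q (return_set T x U).
  by move=> oU U0; apply/(upper_density_gt0P R); exact: xT.
have xB (U : set X) : open U -> U !=set0 ->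
    exists q, banach_dense q (return_set T x U).
  move=> oU U0; have [q _ /upper_dense_banach] := xU U oU U0.
  by exists q.
have [B [/all_and2[oB B0] BU]] := countable_base archi X_separable.
have I0 : (0 < #|'I_n|)%N by rewrite card_ord.
have /choice[q qP] (h : {ffun 'I_n -> nat * nat}) :=
  upper_dense_box cT xB I0 xU (fun i => oB (h i)) (fun i => B0 (h i)).
pose A (h : {ffun 'I_n -> nat * nat}) (y : 'I_n -> X) :=
  [set m | forall i, B (h i) (iter m T (y i))].
pose G (j : {ffun 'I_n -> nat * nat} * nat) : set ('I_n -> X) := fun y =>
  exists2 N, (j.2 <= N)%N & (N <= q j.1 * visits (A j.1 y) 0 N)%N.
have [[h N0] U oU U0|y yG] := @box_baire _ _ _ _ G archi.
  have [y Uy /(_ N0)[N NN0 Ny]] := qP h U oU U0.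
  exists (fun i => U i `&` [set z | forall m : 'I_N,
    B (h i) (iter (0 + m)%N T (y i)) -> B (h i) (iter m T z)]); split.
  - move=> i; apply: openI => //.
    exact: (@open_shadowing _ _ T (B \o h) y N 0 i cT (fun i => oB (h i))).
  - by move=> i; exists (y i); split.
  - by move=> i; exact: subIsetl.
  - move=> z zP; exists N => //; apply: (leq_trans Ny); rewrite leq_mul2l.
    apply/orP; right; apply: visits_mono => m mN Am i; rewrite add0n.
    by have [_ /(_ (Ordinal mN))] := zP i; exact.
exists y => U oU [z Uz].
have [V [VP VU]] := open_ptws_box oU Uz.
have /choice[h hV] i : exists k, B k `<=` V i.
  by have [oV Vz] := VP i; apply: BU => //; exists (z i).
apply/upper_density_gt0P.
have yh N0 := yG ([ffun i => h i], N0); exists (q [ffun i => h i]).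
  have [N /= N1] := yh 1%N; case: (q _) => //; rewrite mul0n; lia.
move=> N0; have [N NN0 Ny] := yh N0; exists N => //; apply: (leq_trans Ny).
rewrite leq_mul2l; apply/orP; right; apply: visits_mono => m _ Am /=.
apply: VU => i; rewrite iter_prod_map; apply: hV.
by have := Am i; rewrite ffunE.
Qed.

(** Every [y] whose orbit visits all boxes infinitely often is a witness: it
    follows [x] along windows of every length.  Visits to infinitely many
    windows of the same length are what the upper limit in the Banach density
    requires. *)
Lemma reiteratively_hypercyclic_prod :
  reiteratively_hypercyclic R (T : X -> X) ->
  reiteratively_hypercyclic R (@prod_map X n T).
Proof.
move=> [x xT].
have xB (U : set X) : open U -> U !=set0 ->
    exists q, banach_dense q (return_set T x U).
  move=> oU U0; have [q _] := upper_banach_density_dense (xT U oU U0).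
  by exists q.
have [B [/all_and2[oB B0] BU]] := countable_base archi X_separable.
pose G (j : {ffun 'I_n -> nat * nat} * nat) : set ('I_n -> X) := fun y =>
  exists2 m, (j.2 <= m)%N & forall i, B (j.1 i) (iter m T (y i)).
have [[h m0] U oU U0|y yG] := @box_baire _ _ _ _ G archi.
  have [m mm0 mP] := weakly_mixing cT xB m0 oU U0 (fun i => oB (h i))
    (fun i => B0 (h i)).
  exists (fun i => U i `&` [set z | B (h i) (iter m T z)]); split.
  - by move=> i; apply: openI => //; apply: open_iter.
  - by move=> i; have [z Uz Bz] := mP i; exists z.
  - by move=> i; exact: subIsetl.
  - by move=> z zP; exists m => // i; have [] := zP i.
have yV (V : 'I_n -> set X) m0 : (forall i, open (V i)) ->
    (forall i, V i !=set0) ->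
    exists2 m, (m0 <= m)%N & forall i, V i (iter m T (y i)).
  move=> oV V0; have /choice[h hV] i := BU _ (oV i) (V0 i).
  have [m mm0 mP] := yG ([ffun i => h i], m0); exists m => // i.
  by apply: hV; have := mP i; rewrite ffunE.
exists y => U oU [z Uz].
have [V [/all_and2[oV Vz] VU]] := open_ptws_box oU Uz.
have /choice[p pV] i : exists m, V i (iter m T x).
  have [|m _ Vm] := orbit_often xB 0 (oV i); first by exists (z i).
  by exists m.
have [q Aq] : exists q,
    banach_dense q (return_set T x [set w | forall i, V i (iter (p i) T w)]).
  apply: xB; last by exists x.
  by apply: open_forall => i; exact: open_iter.
apply: (@often_upper_banach_density _ _ q) => N0.
have [N NN0 [s Ns]] := Aq N0; exists N => // s0.
have [||m ms0 mP] := yV (fun i => [set w | forall l : 'I_N,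
    V i (iter (s + l)%N T (iter (p i) T x)) -> V i (iter l T w)]) s0.
- by move=> i; exact: (@open_shadowing _ _ T V (fun i => iter (p i) T x)).
- by move=> i; exists (iter s T (iter (p i) T x)) => l; rewrite addnC iterD.
exists m => //; apply: (leq_trans Ns); rewrite leq_mul2l; apply/orP; right.
apply: visits_mono => l lN Al /=; apply: VU => i; rewrite iter_prod_map.
rewrite addnC iterD; apply: (mP i (Ordinal lN)) => /=.
by rewrite -iterD addnC iterD; exact: Al.
Qed.

End products.

Theorem mainTheorem2 (R : realType) (k : scalar_kind)
    (X : completeNormedModType (scalars R k))
    (X_separable : separable_space X)
    (X_infinite_dim : ~ finite_dimensional X)
    (T : {linear X -> X}) (T_bounded : bounded_near T (nbhs (0 : X)))
    (n : nat) (n_ge1 : (1 <= n)%N) :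
  (U_frequently_hypercyclic R (T : X -> X) ->
   U_frequently_hypercyclic R (@prod_map X n T)) /\
  (reiteratively_hypercyclic R (T : X -> X) ->
   reiteratively_hypercyclic R (@prod_map X n T)).
Proof.
have cT := bounded_linear_continuous T_bounded.
have archi := @scalars_archimedean R k.
split; first exact: U_frequently_hypercyclic_prod.
exact: reiteratively_hypercyclic_prod.
Qed.
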